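(* Let $n\geq 0$ and let $\bar a=(a_0,\dots,a_n)\in\mathbb{Z}^{n+1}$ with $a_0\geq 0$, $a_1,\dots,a_{n-1}\geq 1$ and $a_n\geq 3-\delta_{n,0}$. Put $d=a_0+\cdots+a_n$ and $\mu=\tfrac{2}{3}(4^{d-1}-1)-\sum_{i=1}^n 4^{a_i+\cdots+a_n-2}$. Then for all coprime integers $a,b$ with $(\mu-1)a<b<(\mu+1)a$ and every nonnegative integer $M$, $$G\bigl(M,M;b/2^{d-1},(b+1/a)/2^{d-1},2^{d-1}a\bigr)\geq 0.$$
   Context: The Gaussian polynomial is $\left[\begin{smallmatrix}m+n\\ m\end{smallmatrix}\right]=\prod_{k=1}^m\frac{1-q^{n+k}}{1-q^k}$ if $m,n\in\{0,1,2,\dots\}$ and $0$ otherwise. For $N,M$ integers, $K$ an integer and $\alpha,\beta$ reals, $G(N,M;\alpha,\beta,K)=\sum_{j=-\infty}^{\infty}(-1)^j q^{Kj((\alpha+\beta)j+\alpha-\beta)/2}\left[\begin{smallmatrix}M+N\\ N-Kj\end{smallmatrix}\right]$ (a finite sum). $P\geq 0$ means all coefficients of $P$ are nonnegative. *)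

(* Defs.v *)
From HB Require Import structures.
From mathcomp Require Import all_boot all_order all_algebra.
From mathcomp Require Import boolp classical_sets fsbigop reals.
From mathcomp Require Import ring.

Set Implicit Arguments.
Unset Strict Implicit.
Unset Printing Implicit Defensive.

Import Order.TTheory GRing.Theory Num.Theory.

Local Open Scope ring_scope.

Definition qprod (n m : nat) : {poly int} :=
  \prod_(1 <= k < m.+1) (1 - 'X^(n + k)).

(* The division in {poly int} is exact: the divisor has leading coefficient
   1 or -1 and divides the dividend, see [gauss_natK]. *)
Definition gauss_nat (n m : nat) : {poly int} := qprod n m %/ qprod 0 m.

(* The Gaussian polynomial with top entry t and bottom entry m. *)
Definition gauss (t m : int) : {poly int} :=
  if (0 <= m) && (0 <= t - m) then gauss_nat `|t - m|%N `|m|%N else 0.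

(* As alpha and beta are real, G is in general a finite combination of real
   powers of q. Such an expression is represented by its coefficient function
   R -> int, mapping x to the coefficient of q^x; [qshift e p] represents
   q^e * p(q). *)
Definition qshift (R : realType) (e : R) (p : {poly int}) : R -> int :=
  fun x => \sum_(i < size p | x == e + i%:R) p`_i.

(* The sum over all j : int is finitely supported as soon as K != 0. *)
Definition G (R : realType) (N M : int) (alpha beta : R) (K : int) : R -> int :=
  fun x => \sum_(j \in [set: int])
    (-1) ^+ `|j|%N *
    qshift (K%:~R * j%:~R * ((alpha + beta) * j%:~R + alpha - beta) / 2)
           (gauss (M + N) (N - K * j)) x.

Definition nonneg_coefs (R : realType) (P : R -> int) : Prop :=
  forall x : R, 0 <= P x.

Definition mu (R : realType) (n : nat) (abar : 'I_n.+1 -> int) : R :=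
  2 / 3 * (4 ^ (\sum_i abar i - 1) - 1)
  - \sum_(i < n.+1 | (0 < i)%N) 4 ^ (\sum_(k < n.+1 | (i <= k)%N) abar k - 2).

Lemma qprodS n m : qprod n m.+1 = qprod n m * (1 - 'X^(n + m.+1)).
Proof. by rewrite /qprod big_nat_recr. Qed.

Lemma qprodSl n m : (1 - 'X^(n.+1)) * qprod n.+1 m = qprod n m.+1.
Proof.
rewrite /qprod [RHS]big_nat_recl // addn1; congr (_ * _).
by apply: eq_big_nat => i _; rewrite addSnnS.
Qed.

Lemma qprod0_unit m : lead_coef (qprod 0 m) \is a GRing.unit.
Proof.
rewrite /qprod; elim: m => [|m IH]; first by rewrite big_nil lead_coef1 unitr1.
rewrite big_nat_recr //= lead_coefM unitrM IH /= add0n.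
rewrite -opprB lead_coefN unitrN.
by have /monicP -> : 'X^(m.+1) - 1 \is @monic int;
  rewrite ?unitr1 // monicXnsubC.
Qed.

Lemma qprod_dvd n m : exists g, qprod n m = g * qprod 0 m.
Proof.
elim: m n => [|m IHm] n.
  by exists 1; rewrite /qprod !big_geq ?mulr1.
elim: n => [|n [g Eg]]; first by exists 1; rewrite mul1r.
have [h Eh] := IHm n.+1.
exists (h + 'X^(m.+1) * g).
rewrite mulrDl -mulrA -Eg -(qprodSl n m) (qprodS 0) mulrA -Eh (qprodS n.+1) add0n exprD.
ring.
Qed.

Lemma gauss_natK n m : gauss_nat n m * qprod 0 m = qprod n m.
Proof.
have [g Eg] := qprod_dvd n m.
by rewrite /gauss_nat Eg Pdiv.IdomainUnit.mulpK ?qprod0_unit.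
Qed.

(* Main.v *)
(* Here the exponent of the j-th term is a b j^2 + j (j - 1) / 2 and its Gaussian
   polynomial is [2M; M + 2^(d-1) a |j|]. Write P(c, K) for nonnegativity, for all
   M, of the alternating sum with exponents c j^2 + j (j - 1) / 2 and Gaussian
   polynomials [2M; M + K |j|].

   Two applications of the q-Vandermonde sum, in its two dual forms, expand
   q^(2 K^2) [2L; L + 2K] and q^(K^2) [2L; L + 2K] as combinations of the
   [2i; i + K] with coefficients in N[q] that do not depend on K. Hence P(c, K)
   implies both P(c + 2 K^2, 2K) and P(c + K^2, 2K). The Burge transform, a form
   of the q-Pfaff-Saalschuetz sum, run along the Euclidean algorithm from the
   pair (1, 1), gives P(a b, a) for coprime 0 < b < a; and P(0, 1) is a case of
   the q-binomial theorem.

   Finally mu is the sum over 0 <= s < d - 1 of eps_s 4^s with eps_s in {1, 2} and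
   eps_0 = 2. With b = mu a + b0 and |b0| < a, starting from P(a b0, a) if
   b0 >= 0, and from P(a (a + b0), a) with eps_0 replaced by 1 if b0 < 0, the
   doubling steps prescribed by the eps_s lead to P(a b, 2^(d-1) a). *)

Require Import Defs.
From mathcomp Require Import all_boot all_order all_algebra.
From mathcomp Require Import boolp classical_sets fsbigop reals.
From mathcomp Require Import ring lra zify.

Set Implicit Arguments.
Unset Strict Implicit.
Unset Printing Implicit Defensive.

Import Order.TTheory GRing.Theory Num.Theory.

Local Open Scope ring_scope.

(** * Gaussian binomials and the two q-Vandermonde sums *)

(** The q-Pascal recursion makes nonnegativity of the coefficients and vanishing for [k > n]
    evident; [gauss_natE] identifies it with the quotient [gauss_nat]. *)
Fixpoint qbin (n k : nat) : {poly int} :=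
  match n, k with
  | _, 0 => 1
  | 0, _.+1 => 0
  | n'.+1, k'.+1 => qbin n' k' + 'X^(k'.+1) * qbin n' k'.+1
  end.

Lemma qbin0 n : qbin n 0 = 1. Proof. by case: n. Qed.

Lemma qbinS n k : qbin n.+1 k.+1 = qbin n k + 'X^(k.+1) * qbin n k.+1.
Proof. by []. Qed.

Lemma qbin_small n k : (n < k)%N -> qbin n k = 0.
Proof.
elim: n k => [|n IH] [|k] //= ltnk.
by rewrite !IH ?mulr0 ?addr0 // ltnW.
Qed.

Lemma qprod0S m : qprod 0 m.+1 = qprod 0 m * (1 - 'X^(m.+1)).
Proof. exact: qprodS. Qed.

Lemma qprod00 : qprod 0 0 = 1.
Proof. by rewrite /qprod big_geq. Qed.

Lemma qprod0_neq0 m : qprod 0 m != 0.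
Proof. by rewrite -lead_coef_eq0; apply: contraTneq (qprod0_unit m) => ->; rewrite unitr0. Qed.

Arguments qbin : simpl never.

(** The q-factorial formula cleared of denominators, (q;q)_m being [qprod 0 m]. Identities between
    products of binomials are then proved by multiplying by nonzero q-factorials. *)
Lemma qbin_fact n k : qbin (n + k) k * (qprod 0 n * qprod 0 k) = qprod 0 (n + k).
Proof.
elim: k n => [|k IHk] n.
  by rewrite addn0 qbin0 qprod00 mulr1 mul1r.
elim: n => [|n IHn].
  have := IHk 0%N; rewrite !add0n => E.
  rewrite qbinS (qbin_small (ltnSn k)) mulr0 addr0 qprod00 mul1r qprod0S mulrA.
  by move: E; rewrite qprod00 mul1r => ->.
rewrite addSn qbinS mulrDl [in RHS]qprod0S.
have E1 := IHk n.+1; rewrite addSnnS in E1.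
have -> : qprod 0 (n + k.+1) * (1 - 'X^((n + k.+1).+1)) =
  qprod 0 (n + k.+1) * (1 - 'X^(k.+1)) + 'X^(k.+1) * (1 - 'X^(n.+1)) * qprod 0 (n + k.+1).
  by rewrite -addSn exprD; ring.
rewrite -{1}E1 -IHn [in LHS](qprod0S k) [in X in _ + X](qprod0S n).
by rewrite !(qprod0S k); ring.
Qed.

Lemma qbin_sym n k : qbin (n + k) k = qbin (n + k) n.
Proof.
apply: (mulIf (mulf_neq0 (qprod0_neq0 n) (qprod0_neq0 k))).
by rewrite qbin_fact [in RHS]addnC [in RHS](mulrC (qprod 0 n)) qbin_fact addnC.
Qed.

Lemma qbin_sub n k : (k <= n)%N -> qbin n (n - k) = qbin n k.
Proof. by move=> le_kn; have := qbin_sym (n - k) k; rewrite subnK. Qed.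

(** The q-Pascal rule after the reflection k -> n - k. *)
Lemma qbinS' n k : qbin n.+1 k.+1 = 'X^(n - k) * qbin n k + qbin n k.+1.
Proof.
have [lt_nk|le_kn] := ltnP n k.
  by rewrite !qbin_small ?mulr0 ?addr0 // ltnW.
have [-> | lt_kn] := eqVneq k n.
  by rewrite subnn qbinS (qbin_small (ltnSn n)) mulr0 addr0 mul1r addr0.
have {}lt_kn : (k < n)%N by rewrite ltn_neqAle lt_kn.
rewrite -qbin_sub // subSS -(prednK (n := n - k)) ?subn_gt0 // qbinS prednK ?subn_gt0 //.
by rewrite qbin_sub // -subnS qbin_sub // addrC.
Qed.

Lemma qbin_trinomial a b c :
  qbin (a + b + c) (a + b) * qbin (a + b) a * (qprod 0 a * qprod 0 b * qprod 0 c)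
  = qprod 0 (a + b + c).
Proof.
have E1 := qbin_fact c (a + b); have E2 := qbin_fact b a.
rewrite (addnC c) in E1; rewrite (addnC b) in E2.
by rewrite -{}E1 -{}E2; ring.
Qed.

Lemma qbin_rev a b c :
  qbin (a + b + c) (a + b) * qbin (a + b) a = qbin (a + b + c) (a + c) * qbin (a + c) a.
Proof.
have nz : qprod 0 a * qprod 0 b * qprod 0 c != 0 by rewrite !mulf_neq0 ?qprod0_neq0.
apply: (mulIf nz); rewrite qbin_trinomial mulrAC addnAC -(qbin_trinomial a c b).
ring.
Qed.

(** Induction on m for all t: [qbinS] on the right and [qbinS'] on the left split both sides into
    the cases t and t + 1. *)
Lemma qbin_vandermonde m n t :
  \sum_(s < m.+1) 'X^(s * (s + t)) * qbin m s * qbin n (s + t) = qbin (m + n) (m + t).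
Proof.
elim: m t => [|m IHm] t.
  by rewrite big_ord_recl big_ord0 qbin0 !mul1r addr0.
rewrite !addSn qbinS -(IHm t) -addnS -IHm mulr_sumr.
rewrite big_ord_recl [in RHS]big_ord_recl !qbin0 /= !mul0n -addrA; congr (_ + _).
transitivity (\sum_(i < m.+1) ('X^(i.+1 * (i.+1 + t)) * qbin m i.+1 * qbin n (i.+1 + t) +
   'X^((m + t).+1) * ('X^(i * (i + t.+1)) * qbin m i * qbin n (i + t.+1)))).
  apply: eq_bigr => i _; rewrite /bump !add1n qbinS' addnS addSn.
  have -> : 'X^((m + t).+1) * ('X^(i * (i + t).+1) * qbin m i * qbin n (i + t).+1) =
    'X^(i.+1 * (i + t).+1) * 'X^(m - i) * qbin m i * qbin n (i + t).+1.
    rewrite -exprD !mulrA -exprD; congr ('X^_ * _ * _).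
    by have := ltn_ord i; lia.
  ring.
rewrite big_split /=; congr (_ + _); last by rewrite addnS.
by rewrite big_ord_recr /= (qbin_small (ltnSn m)) mulr0 mul0r addr0.
Qed.

(** The image of [qbin_vandermonde] under q -> 1/q; the two Pascal rules exchange roles. Where
    [n - t - s] truncates, [qbin n (s + t)] is zero. *)
Lemma qbin_vandermonde' m n t :
  \sum_(s < m.+1) 'X^((m - s) * (n - t - s)) * qbin m s * qbin n (s + t)
  = qbin (m + n) (m + t).
Proof.
elim: m t => [|m IHm] t.
  by rewrite big_ord_recl big_ord0 qbin0 !mul1r addr0.
rewrite !addSn qbinS' -IHm -addnS -IHm mulr_sumr subnDl.
rewrite addrC big_ord_recl qbin0.
transitivity ('X^(m.+1 * (n - t)) * qbin n t +
  \sum_(i < m.+1) ('X^((m - i) * (n - t.+1 - i)) * qbin m i * qbin n (i + t.+1) +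
   'X^(n - t) * ('X^((m - i.+1) * (n - t - i.+1)) * qbin m i.+1 * qbin n (i.+1 + t)))).
  rewrite !subn0 mulr1; congr (_ + _).
  apply: eq_bigr => i _; rewrite !lift0 subSS qbinS addnS addSn.
  have -> : (n - t.+1 - i = n - t - i.+1)%N by lia.
  have [lt_n|le_n] := ltnP n (i + t).+1.
    by rewrite (qbin_small lt_n) !mulr0 addr0.
  have [le_mi|lt_im] := leqP m i.
    have -> : qbin m i.+1 = 0 by rewrite qbin_small.
    by rewrite !(mulr0, mul0r, addr0).
  have -> : 'X^(n - t) * ('X^((m - i.+1) * (n - t - i.+1)) * qbin m i.+1 * qbin n (i + t).+1) =
    'X^((m - i) * (n - t - i.+1)) * 'X^(i.+1) * qbin m i.+1 * qbin n (i + t).+1.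
    rewrite -exprD !mulrA -exprD; congr ('X^_ * _ * _).
    have -> : (n - t = (n - t - i.+1) + i.+1)%N by lia.
    have -> : (m - i = (m - i.+1).+1)%N by lia.
    by rewrite addnK; lia.
  ring.
rewrite big_split /= addrCA; congr (_ + _).
rewrite big_ord_recr /= (qbin_small (ltnSn m)) mulr0 mul0r mulr0 addr0.
rewrite [in RHS]big_ord_recl /=; congr (_ + _).
  by rewrite !subn0 qbin0 mulr1 mulrA -exprD mulSn.
Qed.

Lemma sum_ord_support (F : nat -> {poly int}) n b k : (b + k <= n)%N ->
  (forall i, (i < n)%N -> ~~ (b <= i < b + k)%N -> F i = 0) ->
  \sum_(i < n) F i = \sum_(l < k) F (l + b)%N.
Proof.
move=> le_n F0.
rewrite -(big_mkord xpredT (fun l => F (l + b)%N)).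
rewrite -(big_mkord xpredT F) (big_cat_nat (n := b)) //=; last by lia.
rewrite big1_seq ?add0r; last first.
  by move=> i; rewrite mem_index_iota /= => ?; rewrite F0 //; lia.
rewrite (big_cat_nat (n := b + k)) //=; last by lia.
rewrite [X in _ + X]big1_seq ?addr0; last first.
  by move=> i; rewrite mem_index_iota /= => ?; rewrite F0 //; lia.
by rewrite -{1}[b]add0n big_addn addKn.
Qed.

(** * Expansions of products of two binomials *)

Lemma qbin_4nomial a b c d :
  qbin (a + b + (c + d)) (a + b) * qbin (c + d) c * qbin (a + b) a
    * (qprod 0 a * qprod 0 b * qprod 0 c * qprod 0 d) = qprod 0 (a + b + (c + d)).
Proof.
have E1 := qbin_fact (c + d) (a + b).
have E2 := qbin_fact b a; have E3 := qbin_fact d c.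
rewrite (addnC b) in E2; rewrite (addnC d) in E3; rewrite addnC in E1.
by rewrite -{}E1 -{}E2 -{}E3; ring.
Qed.

(** Both sides are the q-multinomial coefficient with parts a, b, c, d, grouped differently. *)
Lemma qbin_4nomialC a b c d :
  qbin (a + b + (c + d)) (a + b) * qbin (c + d) c * qbin (a + b) a =
  qbin (b + c + (a + d)) (b + c) * qbin (a + d) a * qbin (b + c) b.
Proof.
have nz : qprod 0 a * qprod 0 b * qprod 0 c * qprod 0 d != 0.
  by rewrite !mulf_neq0 ?qprod0_neq0.
apply: (mulIf nz); rewrite qbin_4nomial.
have -> : (a + b + (c + d) = b + c + (a + d))%N by lia.
by rewrite -(qbin_4nomial b c a d); ring.
Qed.

(** For i <= A this is the q-multinomial coefficient with parts 2i, A - i, B - i, zero when i > B.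
    It supplies the weights, free of K, of the expansions below. *)
Definition qtrin A B i := qbin (A + B) (i + i) * qbin (A + B - (i + i)) (A - i).

(** For s <= p both sides are the q-multinomial coefficient with parts s + 2K, s, m - s, p - s. On
    the right s occurs only in two factors, of q-Vandermonde shape. *)
Lemma qtrin_qbin K m p s : (s <= m)%N ->
  qtrin (m + K) (p + K) (s + K) * qbin (s + K + (s + K)) (s + K + K) =
  qbin m s * qbin (p + (K + K)) (s + (K + K)) * qbin (m + p + (K + K)) m.
Proof.
rewrite /qtrin => le_sm.
have [lt_ps|le_sp] := ltnP p s.
  rewrite (qbin_small (n := p + (K + K))%N) ?mulr0 ?mul0r; last by lia.
  have [lt|le] := ltnP (m + K + (p + K)) (s + K + (s + K)).
    by rewrite (qbin_small lt) !mul0r.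
  rewrite (qbin_small (n := m + K + (p + K) - (s + K + (s + K)))%N); last by lia.
  by rewrite mulr0 mul0r.
have := qbin_4nomialC (s + (K + K)) s (m - s) (p - s).
have -> : (s + (K + K) + s + (m - s + (p - s)) = m + K + (p + K))%N by lia.
have -> : (s + (K + K) + s = s + K + (s + K))%N by lia.
have -> : (m - s + (p - s) = m + K + (p + K) - (s + K + (s + K)))%N by lia.
have -> : (s + (m - s) = m)%N by lia.
have -> : (s + (K + K) + (p - s) = p + (K + K))%N by lia.
have -> : (m - s = m + K - (s + K))%N by lia.
have -> : (s + K + K = s + (K + K))%N by lia.
have -> : (m + (p + (K + K)) = m + p + (K + K))%N by lia.
by move->; ring.
Qed.

Lemma qbin_pair_eq0 K A B : ~~ ((K <= A) && (K <= B))%N ->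
  qbin (A + B) (A + K) * qbin (A + B) (B + K) = 0.
Proof.
rewrite negb_and -!ltnNge => /orP[ltK|ltK].
  by rewrite (qbin_small (k := (B + K)%N)) ?mulr0 //; lia.
by rewrite (qbin_small (k := (A + K)%N)) ?mul0r //; lia.
Qed.

Lemma sum_qtrin_eq0 (e : nat -> nat) K A B : ~~ ((K <= A) && (K <= B))%N ->
  \sum_(i < A.+1) 'X^(e i) * qtrin A B i * qbin (i + i) (i + K) = 0.
Proof.
move=> ltK; rewrite big1 // => i _; have le_iA := ltn_ord i.
have [lt_iK|le_Ki] := ltnP i K.
  by rewrite (qbin_small (k := (i + K)%N)) ?mulr0 //; lia.
rewrite /qtrin; have [lt|le] := ltnP (A + B) (i + i).
  by rewrite (qbin_small lt) !(mulr0, mul0r).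
by rewrite (qbin_small (k := (A - i)%N)) ?(mulr0, mul0r) //; lia.
Qed.

Lemma sum_qtrin (e : nat -> nat) K m p :
  \sum_(i < (m + K).+1) 'X^(e i) * qtrin (m + K) (p + K) i * qbin (i + i) (i + K) =
  (\sum_(s < m.+1) 'X^(e (s + K)%N) * qbin m s * qbin (p + (K + K)) (s + (K + K)))
  * qbin (m + p + (K + K)) m.
Proof.
rewrite (sum_ord_support
  (F := fun i => 'X^(e i) * qtrin (m + K) (p + K) i * qbin (i + i) (i + K))
  (b := K) (k := m.+1)); first last.
- move=> i lt_i; rewrite negb_and => out.
  by rewrite (qbin_small (k := (i + K)%N)) ?mulr0 //; lia.
- by lia.
rewrite mulr_suml; apply: eq_bigr => s _.
have le_sm : (s <= m)%N by have := ltn_ord s; lia.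
by rewrite -[LHS]mulrA qtrin_qbin // !mulrA.
Qed.

Lemma qbin_pair K m p :
  qbin (m + K + (p + K)) (m + K + K) * qbin (m + K + (p + K)) (p + K + K) =
  qbin (m + (p + (K + K))) (m + (K + K)) * qbin (m + p + (K + K)) m.
Proof.
have -> : (m + K + (p + K) = m + (p + (K + K)))%N by lia.
have -> : (m + K + K = m + (K + K))%N by lia.
have -> : (m + p + (K + K) = m + (p + (K + K)))%N by lia.
by rewrite -(addnA p) -qbin_sym.
Qed.

(** With i = s + K the square splits as i^2 = K^2 + s (s + 2K), and [qbin_vandermonde] with t = 2K
    sums over s. *)
Lemma qbin_pair_expand K A B :
  'X^(K * K) * (qbin (A + B) (A + K) * qbin (A + B) (B + K)) =
  \sum_(i < A.+1) 'X^(i * i) * qtrin A B i * qbin (i + i) (i + K).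
Proof.
have [/andP[le_KA le_KB] | ltK] := boolP ((K <= A) && (K <= B))%N; last first.
  by rewrite qbin_pair_eq0 // mulr0 (sum_qtrin_eq0 (fun i => i * i)%N).
move: le_KA le_KB => /subnK <- /subnK <-.
rewrite (sum_qtrin (fun i => i * i)%N) qbin_pair -qbin_vandermonde mulrA mulr_sumr.
congr (_ * _); apply: eq_bigr => s _; rewrite !mulrA -exprD; congr ('X^_ * _ * _).
by nia.
Qed.

(** The same substitution with the dual sum: (A - i)(B - i) does not produce a power q^(K^2). *)
Lemma qbin_pair_expand' K A B :
  qbin (A + B) (A + K) * qbin (A + B) (B + K) =
  \sum_(i < A.+1) 'X^((A - i) * (B - i)) * qtrin A B i * qbin (i + i) (i + K).
Proof.
have [/andP[le_KA le_KB] | ltK] := boolP ((K <= A) && (K <= B))%N; last first.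
  by rewrite qbin_pair_eq0 // (sum_qtrin_eq0 (fun i => (A - i) * (B - i))%N).
move: le_KA le_KB => /subnK <- /subnK <-.
rewrite (sum_qtrin (fun i => (_ - i) * (_ - i))%N) qbin_pair -qbin_vandermonde'.
congr (_ * _); apply: eq_bigr => s _; congr ('X^_ * _ * _).
by rewrite !subnDr addnK.
Qed.

(** This is [qbin_vandermonde] with m = n = L, t = 2K and A = s + K, after completing the square.
    Writing L as [A + (L - A)] gives each term the shape of the pair expansions. *)
Lemma qbin_double K L :
  'X^(K * K) * qbin (L + L) (L + (K + K)) =
  \sum_(A < L.+1) 'X^(A * A) *
    (qbin (A + (L - A)) (A + K) * qbin (A + (L - A)) (L - A + K)).
Proof.
have [lt_LK|le_KL] := ltnP L K.
  rewrite qbin_small ?mulr0; last by lia.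
  rewrite big1 // => A _; have le_AL := ltn_ord A.
  by rewrite qbin_pair_eq0 ?mulr0 //; lia.
rewrite -qbin_vandermonde mulr_sumr.
rewrite [RHS](sum_ord_support (F := fun A => 'X^(A * A) *
    (qbin (A + (L - A)) (A + K) * qbin (A + (L - A)) (L - A + K)))
  (b := K) (k := (L - K).+1)); first last.
- move=> A le_AL out; rewrite qbin_pair_eq0 ?mulr0 //; lia.
- by lia.
rewrite (sum_ord_support (F := fun s => 'X^(K * K) *
  ('X^(s * (s + (K + K))) * qbin L s * qbin L (s + (K + K))))
  (b := 0) (k := (L - K).+1)); first last.
- move=> s le_sL out.
  by rewrite (qbin_small (k := (s + (K + K))%N)) ?mulr0 //; lia.
- by lia.
apply: eq_bigr => s _; have le_sL := ltn_ord s.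
rewrite addn0 subnKC; last by lia.
have -> : (L - (s + K) + K = L - s)%N by lia.
rewrite qbin_sub; last by lia.
have -> : ((s + K) * (s + K) = K * K + s * (s + (K + K)))%N by lia.
by rewrite -(addnA s) exprD; ring.
Qed.

(** * The q-Pfaff-Saalschuetz sum *)

Lemma qbin_revl a b c :
  qbin (a + b + c) (a + b) * qbin (a + b) a = qbin (a + b + c) a * qbin (b + c) b.
Proof.
have nz : qprod 0 a * qprod 0 b * qprod 0 c != 0 by rewrite !mulf_neq0 ?qprod0_neq0.
apply: (mulIf nz); rewrite qbin_trinomial.
have E1 := qbin_fact (b + c) a; have E2 := qbin_fact c b.
rewrite addnC addnA in E1; rewrite (addnC c) in E2.
by rewrite -{}E1 -{}E2; ring.
Qed.

(* Expand by q-Vandermonde, first in k and then in l, and sum over k by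
   q-Vandermonde again. *)
Lemma qbin_saalschutz p r m t :
  \sum_(l < p.+1) 'X^(l * (l + t)) * qbin (p - l + (r + m)) (p + r)
    * qbin p l * qbin r (l + t)
  = qbin (p + (m + t)) (p + t) * qbin (r + m) (m + t).
Proof.
have rev k : qbin (m + t) (k + t) * qbin (r + m) (m + t) =
    qbin (r + m) (r + k) * qbin (k + r) (k + t).
  have [lt_mk|le_km] := ltnP m k.
    rewrite (qbin_small (n := (m + t)%N)) ?(qbin_small (n := (r + m)%N) (k := (r + k)%N)) ?mul0r //; lia.
  have [lt_rt|le_tr] := ltnP r t.
    rewrite (qbin_small (n := (r + m)%N)) ?(qbin_small (n := (k + r)%N)) ?mulr0 //; lia.
  have := qbin_rev (k + t) (m - k) (r - t).
  have -> : (k + t + (m - k) + (r - t) = r + m)%N by lia.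
  have -> : (k + t + (m - k) = m + t)%N by lia.
  have -> : (k + t + (r - t) = k + r)%N by lia.
  by rewrite mulrC (addnC r k).
rewrite -(qbin_vandermonde p (m + t) t) mulr_suml.
transitivity (\sum_(k < p.+1) \sum_(l < p.+1)
  'X^(k * (k + t) + (k - l) * (r - t - l)) * qbin p k * qbin k l
    * qbin (r + m) (r + k) * qbin r (l + t)); last first.
  apply: eq_bigr => k _; have le_kp := ltn_ord k.
  rewrite -[RHS]mulrA rev -(qbin_vandermonde' k r t) !mulr_sumr.
  rewrite (sum_ord_support (F := fun l => 'X^(k * (k + t) + (k - l) * (r - t - l))
    * qbin p k * qbin k l * qbin (r + m) (r + k) * qbin r (l + t)) (b := 0) (k := k.+1)).
  + by apply: eq_bigr => l _; rewrite addn0 exprD; ring.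
  + by lia.
  + by move=> l le_lp out; rewrite (qbin_small (n := k)) ?(mulr0, mul0r) //; lia.
rewrite exchange_big /=; apply: eq_bigr => l _.
have le_lp : (l <= p)%N by have := ltn_ord l; lia.
have -> : (p + r = p - l + (r + l))%N by lia.
rewrite -(qbin_vandermonde (p - l) (r + m) (r + l)) mulr_sumr !mulr_suml.
rewrite [RHS](sum_ord_support (F := fun k => 'X^(k * (k + t) + (k - l) * (r - t - l))
    * qbin p k * qbin k l * qbin (r + m) (r + k) * qbin r (l + t))
    (b := l) (k := (p - l).+1)); first last.
- by move=> k le_kp out; rewrite (qbin_small (n := k)) ?(mulr0, mul0r) //; lia.
- by lia.
apply: eq_bigr => v _; have le_v := ltn_ord v.
have [lt_r|le_r] := ltnP r (l + t).
  by rewrite (qbin_small lt_r) !mulr0.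
have E := qbin_revl l v (p - l - v).
have e1 : (l + v + (p - l - v) = p)%N by lia.
have e2 : (v + (p - l - v) = p - l)%N by lia.
rewrite e1 e2 addnC in E.
have -> : (v + (r + l) = r + (v + l))%N by lia.
rewrite addnK -(mulrA _ (qbin p (v + l))) E.
have -> : ((v + l) * (v + l + t) + v * (r - t - l) = l * (l + t) + v * (r + (v + l)))%N.
  by nia.
by rewrite exprD; ring.
Qed.

(** * Alternating theta sums *)

Definition pnonneg (p : {poly int}) := forall k, 0 <= p`_k.

Lemma pnonnegD p r : pnonneg p -> pnonneg r -> pnonneg (p + r).
Proof. by move=> p0 r0 k; rewrite coefD addr_ge0. Qed.

Lemma pnonnegM p r : pnonneg p -> pnonneg r -> pnonneg (p * r).
Proof. by move=> p0 r0 k; rewrite coefM sumr_ge0 // => i _; rewrite mulr_ge0. Qed.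

Lemma pnonneg0 : pnonneg 0.
Proof. by move=> k; rewrite coef0. Qed.

Lemma pnonneg_nat n : pnonneg n%:R.
Proof. by move=> k; rewrite -polyC_natr coefC; case: ifP. Qed.

Lemma pnonnegXn n : pnonneg 'X^n.
Proof. by move=> k; rewrite coefXn ler0n. Qed.

Lemma pnonneg_sum (I : Type) (r : seq I) (P : pred I) F :
  (forall i, P i -> pnonneg (F i)) -> pnonneg (\sum_(i <- r | P i) F i).
Proof. exact: (big_ind pnonneg pnonneg0 pnonnegD). Qed.

Lemma pnonneg_qbin n k : pnonneg (qbin n k).
Proof.
elim: n k => [|n IHn] [|k]; rewrite ?qbin0 ?qbinS; try exact: (pnonneg_nat 1).
  by rewrite qbin_small //; apply: pnonneg0.
by apply: pnonnegD => //; apply: pnonnegM => //; apply: pnonnegXn.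
Qed.

Lemma pnonneg_qtrin A B i : pnonneg (qtrin A B i).
Proof. by apply: pnonnegM; apply: pnonneg_qbin. Qed.

(* The nonnegative integer j (j - 1) / 2. *)
Definition tri (j : int) : nat :=
  match j with Posz m => 'C(m, 2) | Negz m => 'C(m.+2, 2) end.

Lemma triE j : (tri j)%:Z * 2 = j * (j - 1).
Proof.
have bin2Z m : ('C(m.+1, 2))%:Z * 2 = m%:Z * (m%:Z + 1).
  elim: m => [|m IHm]; first by rewrite bin_small.
  by rewrite binS bin1 PoszD mulrDl IHm -addn1 PoszD; ring.
case: j => [[|m]|m] /=; first by rewrite bin_small.
  by rewrite bin2Z -addn1 PoszD; ring.
by rewrite bin2Z NegzE; ring.
Qed.

(* The sum over |j| <= N of (-1)^j q^(c j^2 + j (j - 1) / 2) F(|j|). *)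
Definition theta_sum (N c : nat) (F : nat -> {poly int}) : {poly int} :=
  \sum_(i < (N + N).+1) (-1) ^+ `|i%:Z - N%:Z|%N *
    ('X^(c * (`|i%:Z - N%:Z| * `|i%:Z - N%:Z|) + tri (i%:Z - N%:Z)) * F `|i%:Z - N%:Z|%N).

(** The mechanism of every positivity transfer: the weights [w i] do not depend on x, hence not on
    j, so the expansion commutes with the alternating sum. *)
Lemma theta_sum_comb (I : Type) (r : seq I) (P : pred I) N c w (F : I -> nat -> {poly int}) G :
  (forall x, G x = \sum_(i <- r | P i) w i * F i x) ->
  (forall i, P i -> pnonneg (w i)) ->
  (forall i, P i -> pnonneg (theta_sum N c (F i))) ->
  pnonneg (theta_sum N c G).
Proof.
move=> GE w0 F0.
have -> : theta_sum N c G = \sum_(i <- r | P i) w i * theta_sum N c (F i).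
  rewrite /theta_sum; under [RHS]eq_bigr do rewrite mulr_sumr.
  rewrite exchange_big /=; apply: eq_bigr => j _.
  by rewrite GE !mulr_sumr; apply: eq_bigr => i _; ring.
by apply: pnonneg_sum => i Pi; apply: pnonnegM; [apply: w0|apply: F0].
Qed.

(** Part of the quadratic exponent moves into F, where it serves as the prefactor that the
    expansions require. *)
Lemma theta_sum_shift N c e F :
  theta_sum N (c + e) F = theta_sum N c (fun x => 'X^(e * (x * x)) * F x).
Proof.
apply: eq_bigr => i _; congr (_ * _); rewrite mulrA -exprD; congr ('X^_ * _).
by rewrite mulnDl addnAC.
Qed.

Lemma eq_theta_sum N c F G : F =1 G -> theta_sum N c F = theta_sum N c G.
Proof. by move=> FG; apply: eq_bigr => i _; rewrite FG. Qed.

(** The homogeneous form allows y to be a power of q, so that no negative powers are needed. *)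
Lemma qbin_theorem n (y : {poly int}) :
  \sum_(k < n.+1) (-1) ^+ k * 'X^('C(k, 2)) * y ^+ (n - k) * qbin n k
  = \prod_(l < n) (y - 'X^l).
Proof.
elim: n => [|n IHn].
  by rewrite big_ord_recl !big_ord0 qbin0 bin_small //= !mulr1 addr0.
rewrite [in RHS]big_ord_recr /= -IHn mulrBr big_ord_recl qbin0 subn0 bin_small // !expr0 !mulr1.
have E (i : 'I_n.+1) : true ->
    (-1) ^+ lift ord0 i * 'X^('C(lift ord0 i, 2)) * y ^+ (n.+1 - lift ord0 i) * qbin n.+1 (lift ord0 i)
    = (-1) ^+ i.+1 * 'X^('C(i.+1, 2)) * y ^+ (n - i) * qbin n i.+1
      - (-1) ^+ i * 'X^('C(i, 2)) * y ^+ (n - i) * qbin n i * 'X^n.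
  move=> _; rewrite lift0 subSS qbinS' mulrDr addrC; congr (_ + _).
  have le_in := ltn_ord i; have -> : 'X^n = 'X^i * 'X^(n - i) :> {poly int}.
    by rewrite -exprD subnKC.
  by rewrite binS bin1 !exprD exprS; ring.
rewrite (eq_bigr _ E) big_split /= sumrN -!mulr_suml addrA; congr (_ - _).
rewrite big_ord_recr /= (qbin_small (ltnSn n)) mulr0 addr0 mulr_suml.
rewrite [in RHS]big_ord_recl /= subn0 qbin0 bin_small // !expr0 !mul1r mulr1 -exprSr.
congr (_ + _); apply: eq_bigr => i _; rewrite /bump !add1n.
have lt_in := ltn_ord i; have -> : (n - i = (n - i.+1).+1)%N by lia.
by rewrite [y ^+ _.+1]exprSr; ring.
Qed.

Lemma theta_sum_qbin N i : (i <= N)%N ->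
  theta_sum N 0 (fun x => qbin (i + i) (i + x)) = (i == 0%N)%:R.
Proof.
move=> le_iN.
pose F m := (-1) ^+ `|m%:Z - N%:Z|%N *
    ('X^(0 * (`|m%:Z - N%:Z| * `|m%:Z - N%:Z|) + tri (m%:Z - N%:Z))
     * qbin (i + i) (i + `|m%:Z - N%:Z|%N)).
rewrite /theta_sum (@sum_ord_support F _ (N - i) (i + i).+1); first last.
- by move=> m le_m out; rewrite /F qbin_small ?mulr0 //; lia.
- by lia.
have nzX n : 'X^n != 0 :> {poly int} by rewrite expf_neq0 // polyX_eq0.
(* With j = l - i, the factor (-1)^i q^(2 i^2) turns the sum into [qbin_theorem] at y = q^i; for i >
   0 the product contains the zero factor l = i. *)
suff E : (-1) ^+ i * 'X^(i * (i + i)) * \sum_(l < (i + i).+1) F (l + (N - i))%N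
    = 'X^('C(i.+1, 2)) * \prod_(l < i + i) ('X^i - 'X^l).
  have [i0|i_neq0] := eqVneq i 0%N.
    by move: E; rewrite i0 !expr0 !mul1r big_ord0.
  have nz : (-1) ^+ i * 'X^(i * (i + i)) != 0 :> {poly int}.
    by rewrite mulf_neq0 ?signr_eq0.
  apply: (mulfI nz).
  have lt_i : (i < i + i)%N by lia.
  by rewrite E (bigD1 (Ordinal lt_i)) //= subrr mul0r !mulr0.
rewrite -qbin_theorem !mulr_sumr; apply: eq_bigr => l _.
have le_l := ltn_ord l; rewrite /F.
have -> : ((l + (N - i))%N%:Z - N%:Z = l%:Z - i%:Z) by lia.
have -> : qbin (i + i) (i + `|l%:Z - i%:Z|%N) = qbin (i + i) l.
  have [le_li|lt_il] := leqP l i.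
    by rewrite -(@qbin_sub _ l); last (by lia); congr qbin; lia.
  by congr qbin; lia.
have -> : (-1) ^+ `|l%:Z - i%:Z|%N = (-1) ^+ i * (-1) ^+ l :> {poly int}.
  rewrite -exprD -[LHS]signr_odd -[RHS]signr_odd; congr (_ ^+ nat_of_bool _); lia.
have -> : (-1) ^+ i * 'X^(i * (i + i)) * ((-1) ^+ i * (-1) ^+ l *
   ('X^(0 * (`|l%:Z - i%:Z| * `|l%:Z - i%:Z|) + tri (l%:Z - i%:Z)) * qbin (i + i) l)) =
   ((-1) ^+ i * (-1) ^+ i) * (-1) ^+ l * 'X^(i * (i + i) + tri (l%:Z - i%:Z)) * qbin (i + i) l.
  by rewrite mul0n add0n exprD; ring.
rewrite -expr2 sqrr_sign mul1r.
have -> : (i * (i + i) + tri (l%:Z - i%:Z) = 'C(i.+1, 2) + 'C(l, 2) + i * (i + i - l))%N.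
  have E1 := triE (l%:Z - i%:Z); have E2 := triE l%:Z; have E3 := triE (- i%:Z).
  have E4 : tri (- i%:Z) = 'C(i.+1, 2) by case: (i) => //=.
  rewrite -E4 /= in E2 E3 *.
  have -> : (i * (i + i - l) = i * i + i * i - i * l)%N by rewrite mulnBr mulnDr.
  have : (i * l <= i * i + i * i)%N by rewrite -mulnDr leq_mul2l; lia.
  move: E1 E2 E3; clear; move: (tri (l%:Z - i%:Z)) (tri (- i%:Z)) ('C(l, 2)) => T1 T2 T3.
  move: (nat_of_ord l) => {}l; lia.
by rewrite !exprD exprM; ring.
Qed.

(** This is P(c, K) for all L up to N. The common range |j| <= N lets sums for different L be
    combined term by term. *)
Definition binom_pos N c K := forall L, (L <= N)%N ->
  pnonneg (theta_sum N c (fun x => qbin (L + L) (L + K * x))).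

Lemma pnonneg_qtrin_sum N c (e : nat -> nat) K A B : (A <= N)%N -> binom_pos N c K ->
  pnonneg (theta_sum N c (fun x =>
    \sum_(i < A.+1) 'X^(e i) * qtrin A B i * qbin (i + i) (i + K * x))).
Proof.
move=> le_AN posK; apply: theta_sum_comb => // i _.
  by apply: pnonnegM; [apply: pnonnegXn | apply: pnonneg_qtrin].
by apply: posK; have := ltn_ord i; lia.
Qed.

(** Of the two factors q^(K^2 x^2), one is consumed by [qbin_double], the other by
    [qbin_pair_expand]. *)
Lemma binom_pos_double2 N c K :
  binom_pos N c K -> binom_pos N (c + K * K * 2) (K * 2).
Proof.
move=> posK L le_LN; rewrite theta_sum_shift.
pose F (A : 'I_L.+1) x := \sum_(i < A.+1)
  'X^(i * i) * qtrin A (L - A) i * qbin (i + i) (i + K * x).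
apply: (@theta_sum_comb 'I_L.+1 (index_enum 'I_L.+1) xpredT N c (fun A : 'I_L.+1 => 'X^(A * A)) F) => [x|A _|A _].
- have -> : (K * K * 2 * (x * x) = K * x * (K * x) + K * x * (K * x))%N by lia.
  have -> : (K * 2 * x = K * x + K * x)%N by lia.
  rewrite exprD -mulrA qbin_double mulr_sumr; apply: eq_bigr => A _.
  by rewrite mulrCA qbin_pair_expand.
- exact: pnonnegXn.
apply: (pnonneg_qtrin_sum (fun i => i * i)%N) => //.
by have := ltn_ord A; lia.
Qed.

(** Here [qbin_double] consumes the only factor q^(K^2 x^2), and [qbin_pair_expand'] needs none. *)
Lemma binom_pos_double1 N c K :
  binom_pos N c K -> binom_pos N (c + K * K) (K * 2).
Proof.
move=> posK L le_LN; rewrite theta_sum_shift.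
pose F (A : 'I_L.+1) x := \sum_(i < A.+1)
  'X^((A - i) * (L - A - i)) * qtrin A (L - A) i * qbin (i + i) (i + K * x).
apply: (@theta_sum_comb 'I_L.+1 (index_enum 'I_L.+1) xpredT N c (fun A : 'I_L.+1 => 'X^(A * A)) F) => [x|A _|A _].
- have -> : (K * K * (x * x) = K * x * (K * x))%N by lia.
  have -> : (K * 2 * x = K * x + K * x)%N by lia.
  by rewrite qbin_double; apply: eq_bigr => A _; rewrite qbin_pair_expand'.
- exact: pnonnegXn.
apply: (pnonneg_qtrin_sum (fun i => (A - i) * (L - A - i))%N) => //.
by have := ltn_ord A; lia.
Qed.

Lemma binom_pos01 N : binom_pos N 0 1.
Proof.
move=> L le_LN; rewrite -[X in theta_sum _ X](mul0n 0).
under eq_theta_sum do rewrite mul1n.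
by rewrite theta_sum_qbin //; apply: pnonneg_nat.
Qed.

(** * The Burge transform *)

(* The guards replace the convention that Gaussian polynomials with negative
   entries vanish. *)
Definition burge L M a b : {poly int} :=
  if (a <= L)%N && (b <= M)%N then
    qbin (L + M + a - b) (L + a) * qbin (L + M + b - a) (M + b) else 0.

Lemma burgeC L M a b : burge M L b a = burge L M a b.
Proof. by rewrite /burge andbC (addnC M) mulrC. Qed.

(** With i = l + b and i^2 = b^2 + l (l + 2b) this is [qbin_saalschutz] at p = L + a - b, r = L + b
    - a, m = M - b, t = 2b. The weights are free of a and b. *)
Lemma burge_transform L M a b :
  'X^(b * b) * burge L M (a + b) b =
  \sum_(i < L.+1) 'X^(i * i) * qbin (L + L + M - i) (L + L) * burge (L - i) i a b.
Proof.
have [|out] := boolP ((a + b <= L) && (b <= M))%N; last first.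
  rewrite /burge (negbTE out) mulr0 big1 // => i _; have le_iL := ltn_ord i.
  case: ifP => [/andP[le_a le_b]|]; last by rewrite mulr0.
  (* The guards give a + b <= L, so M < b <= i and the weight vanishes. *)
  by rewrite (qbin_small (k := (L + L)%N)) ?mulr0 ?mul0r //; lia.
case/andP=> le_abL le_bM; rewrite /burge le_abL le_bM /=.
rewrite (sum_ord_support (F := fun i => 'X^(i * i) * qbin (L + L + M - i) (L + L) *
  (if (a <= L - i)%N && (b <= i)%N then
    qbin (L - i + i + a - b) (L - i + a) * qbin (L - i + i + b - a) (i + b) else 0))
  (b := b) (k := (L - a - b).+1)); first last.
- by move=> i le_iL out; rewrite ifF ?mulr0 //; lia.
- by lia.
have := qbin_saalschutz (L + a - b) (L + b - a) (M - b) (b + b).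
rewrite (@sum_ord_support (fun l => 'X^(l * (l + (b + b)))
   * qbin (L + a - b - l + (L + b - a + (M - b))) (L + a - b + (L + b - a))
   * qbin (L + a - b) l * qbin (L + b - a) (l + (b + b))) _ 0 (L - a - b).+1); first last.
- by move=> l le_l out; rewrite (qbin_small (n := (L + b - a)%N)) ?mulr0 //; lia.
- by lia.
have -> : (L + a - b + (M - b + (b + b)) = L + M + (a + b) - b)%N by lia.
have -> : (L + a - b + (b + b) = L + (a + b))%N by lia.
have -> : (L + b - a + (M - b) = L + M + b - (a + b))%N by lia.
have -> : (M - b + (b + b) = M + b)%N by lia.
move=> <-; rewrite mulr_sumr; apply: eq_bigr => l _; have le_l := ltn_ord l.
rewrite addn0 ifT; last by lia.
rewrite -(@qbin_sub (L + a - b) l); last by lia.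
have -> : (L - (l + b) + (l + b) + a - b = L + a - b)%N by lia.
have -> : (L - (l + b) + (l + b) + b - a = L + b - a)%N by lia.
have -> : (L - (l + b) + a = L + a - b - l)%N by lia.
have -> : (l + b + b = l + (b + b))%N by lia.
have -> : (L + a - b - l + (L + M + b - (a + b)) = L + L + M - (l + b))%N by lia.
have -> : (L + a - b + (L + b - a) = L + L)%N by lia.
have -> : ((l + b) * (l + b) = b * b + l * (l + (b + b)))%N by lia.
by rewrite exprD; ring.
Qed.

(* The limit M -> oo of burge_transform. *)
Lemma burge_limit L a b :
  'X^(b * b) * qbin (L + L) (L + (a + b)) =
  \sum_(i < L.+1) 'X^(i * i) * burge (L - i) i a b.
Proof.
have [le_abL|lt_Lab] := leqP (a + b) L; last first.
  rewrite qbin_small ?mulr0; last by lia.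
  by rewrite big1 // => i _; have le_iL := ltn_ord i; rewrite /burge ifF ?mulr0 //; lia.
rewrite /burge.
rewrite (sum_ord_support (F := fun i => 'X^(i * i) *
  (if (a <= L - i)%N && (b <= i)%N then
    qbin (L - i + i + a - b) (L - i + a) * qbin (L - i + i + b - a) (i + b) else 0))
  (b := b) (k := (L - a - b).+1)); first last.
- by move=> i le_iL out; rewrite ifF ?mulr0 //; lia.
- by lia.
(* This sum is the limit m -> oo of [qbin_saalschutz] at the parameters used before. *)
have := qbin_vandermonde (L + a - b) (L + b - a) (b + b).
rewrite (@sum_ord_support (fun l => 'X^(l * (l + (b + b)))
   * qbin (L + a - b) l * qbin (L + b - a) (l + (b + b))) _ 0 (L - a - b).+1); first last.
- by move=> l le_l out; rewrite (qbin_small (n := (L + b - a)%N)) ?mulr0 //; lia.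
- by lia.
have -> : (L + a - b + (b + b) = L + (a + b))%N by lia.
have -> : (L + a - b + (L + b - a) = L + L)%N by lia.
move=> <-; rewrite mulr_sumr; apply: eq_bigr => l _; have le_l := ltn_ord l.
rewrite addn0 ifT; last by lia.
rewrite -(@qbin_sub (L + a - b) l); last by lia.
have -> : (L - (l + b) + (l + b) + a - b = L + a - b)%N by lia.
have -> : (L - (l + b) + (l + b) + b - a = L + b - a)%N by lia.
have -> : (L - (l + b) + a = L + a - b - l)%N by lia.
have -> : (l + b + b = l + (b + b))%N by lia.
have -> : ((l + b) * (l + b) = b * b + l * (l + (b + b)))%N by lia.
by rewrite exprD; ring.
Qed.

(** Bounding L + M fits the transform, which replaces (L, M) by (L - i, i), of sum L. *)
Definition burge_pos N a b := forall L M, (L + M <= N)%N ->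
  pnonneg (theta_sum N (a * b) (fun x => burge L M (a * x) (b * x))).

(** For a = b = 1 the factor q^(x^2) is the one in [qbin_pair_expand], and each resulting
    alternating sum is 0 or 1. *)
Lemma burge_pos11 N : burge_pos N 1 1.
Proof.
move=> L M le_LMN; rewrite -[X in theta_sum _ X]add0n theta_sum_shift.
apply: (@theta_sum_comb 'I_L.+1 (index_enum 'I_L.+1) xpredT N 0
  (fun i => 'X^(i * i) * qtrin L M i) (fun i x => qbin (i + i) (i + x))) => [x|i _|i _].
- rewrite !mul1n -qbin_pair_expand /burge addnK.
  by case: ifPn => // out; rewrite qbin_pair_eq0.
- by apply: pnonnegM; [apply: pnonnegXn | apply: pnonneg_qtrin].
rewrite theta_sum_qbin; first exact: pnonneg_nat.
by have := ltn_ord i; lia.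
Qed.

Lemma burge_posC N a b : burge_pos N a b -> burge_pos N b a.
Proof.
move=> pos L M le_LMN; rewrite mulnC.
under eq_theta_sum do rewrite burgeC.
by apply: pos; rewrite addnC.
Qed.

(** Since (a + b) b = a b + b^2, the surplus q^(b^2 x^2) is the prefactor of [burge_transform]. *)
Lemma burge_posD N a b : burge_pos N a b -> burge_pos N (a + b) b.
Proof.
move=> pos L M le_LMN; rewrite mulnDl theta_sum_shift.
apply: (@theta_sum_comb 'I_L.+1 (index_enum 'I_L.+1) xpredT N (a * b)
  (fun i => 'X^(i * i) * qbin (L + L + M - i) (L + L))
  (fun i x => burge (L - i) i (a * x) (b * x))) => [x|i _|i _].
- rewrite -burge_transform mulnDl; congr ('X^_ * _); lia.
- by apply: pnonnegM; [apply: pnonnegXn | apply: pnonneg_qbin].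
by apply: pos; have := ltn_ord i; lia.
Qed.

Lemma coprime_subl a b : (b <= a)%N -> coprime (a - b) b = coprime a b.
Proof.
by move=> le_ba; rewrite -{2}(subnK le_ba) coprime_sym [RHS]coprime_sym /coprime gcdnDr.
Qed.

Lemma burge_pos_coprime N a b :
  (0 < a)%N -> (0 < b)%N -> coprime a b -> burge_pos N a b.
Proof.
have [k] := ubnP (a + b); elim: k a b => // k IH a b lt_k a_gt0 b_gt0 co_ab.
case: (ltngtP a b) => [lt_ab|lt_ba|eq_ab].
- apply: burge_posC; rewrite -(subnK (ltnW lt_ab)); apply: burge_posD.
  by apply: IH; rewrite ?subn_gt0 ?coprime_subl 1?coprime_sym //; lia.
- rewrite -(subnK (ltnW lt_ba)); apply: burge_posD.
  by apply: IH; rewrite ?subn_gt0 ?coprime_subl //; lia.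
suff [-> ->] : a = 1%N /\ b = 1%N by apply: burge_pos11.
by move: co_ab; rewrite eq_ab /coprime gcdnn => /eqP->.
Qed.

(** Start from the Burge pair (a - b, b) and apply [burge_limit], using a b = (a - b) b + b^2. *)
Lemma binom_pos_coprime N a b :
  (0 < b)%N -> (b < a)%N -> coprime a b -> binom_pos N (a * b) a.
Proof.
move=> b_gt0 lt_ba co_ab L le_LN.
have posB : burge_pos N (a - b) b.
  by apply: burge_pos_coprime; rewrite ?subn_gt0 ?coprime_subl // ltnW.
have -> : (a * b = (a - b) * b + b * b)%N by rewrite -mulnDl subnK // ltnW.
rewrite theta_sum_shift.
apply: (@theta_sum_comb 'I_L.+1 (index_enum 'I_L.+1) xpredT N ((a - b) * b)
  (fun i => 'X^(i * i))
  (fun i x => burge (L - i) i ((a - b) * x) (b * x))) => [x|i _|i _].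
- rewrite -burge_limit -mulnDl subnK 1?ltnW //; congr ('X^_ * _); lia.
- exact: pnonnegXn.
by apply: posB; have := ltn_ord i; lia.
Qed.

(** * Iterated doubling along base-4 digits *)

(** At step s the modulus is 2^s K, so a doubling adds 4^s K^2 once or twice. *)
Lemma binom_pos_chain N c K (eps : nat -> nat) D :
  (forall s, eps s \in [:: 1; 2]%N) -> binom_pos N c K ->
  binom_pos N (c + (\sum_(s < D) eps s * 4 ^ s) * (K * K)) (K * 2 ^ D).
Proof.
move=> eps12 posK; elim: D => [|D IHD].
  by rewrite big_ord0 addn0 muln1.
rewrite big_ord_recr /= expnSr (mulnA K).
have E4 : (4 ^ D = 2 ^ D * 2 ^ D)%N by rewrite -expnMn.
have := eps12 D; rewrite !inE => /orP[] /eqP->; rewrite E4.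
  have := binom_pos_double1 IHD; set S := (\sum_(s < D) _)%N => ?.
  by have <- : (c + S * (K * K) + K * 2 ^ D * (K * 2 ^ D) =
    c + (S + 1 * (2 ^ D * 2 ^ D)) * (K * K))%N by lia.
have := binom_pos_double2 IHD; set S := (\sum_(s < D) _)%N => ?.
by have <- : (c + S * (K * K) + K * 2 ^ D * (K * 2 ^ D) * 2 =
  c + (S + 2 * (2 ^ D * 2 ^ D)) * (K * K))%N by lia.
Qed.

(* For b0 < 0 the first factor 2 is traded for a factor 1:
   a b0 + 2 a^2 = a (a + b0) + a^2. *)
Lemma binom_pos_coprime_chain N (a c : nat) (b0 : int) (eps : nat -> nat) D :
  (`|b0| < a)%N -> coprime a `|b0| ->
  (forall s, eps s \in [:: 1; 2]%N) -> eps 0%N = 2%N ->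
  c%:Z = a%:Z * b0 + (\sum_(s < D.+1) eps s * 4 ^ s)%N%:Z * (a%:Z * a%:Z) ->
  binom_pos N c (a * 2 ^ D.+1).
Proof.
move=> lt_b0 co_ab eps12 eps0.
have [b0_ge0|b0_lt0] := leP 0 b0 => cE.
  have -> : (c = a * `|b0| + (\sum_(s < D.+1) eps s * 4 ^ s) * (a * a))%N by lia.
  apply: binom_pos_chain => //.
  (* If b0 = 0, coprimality forces a = 1, the case P(0, 1). *)
  have [b00|b0_neq0] := eqVneq `|b0|%N 0%N; last first.
    by apply: binom_pos_coprime; rewrite ?lt0n.
  move: co_ab; rewrite b00 muln0 /coprime gcdn0 => /eqP->.
  exact: binom_pos01.
pose eps' s := if s == 0%N then 1%N else eps s.
have eps'12 s : eps' s \in [:: 1; 2]%N by rewrite /eps'; case: ifP.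
have E : (\sum_(s < D.+1) eps s * 4 ^ s = 1 + \sum_(s < D.+1) eps' s * 4 ^ s)%N.
  by rewrite !big_ord_recl /= eps0 /eps' /= !expn0 !muln1 addnA.
have -> : (c = a * (a - `|b0|) + (\sum_(s < D.+1) eps' s * 4 ^ s) * (a * a))%N.
  rewrite mulnBr; move: cE; rewrite E; move: (\sum_(s < _) _)%N => S.
  have : (a * `|b0| <= a * a)%N by rewrite leq_mul2l ltnW ?orbT.
  have -> : b0 = - `|b0|%N%:Z by lia.
  by rewrite !abszN; lia.
apply: binom_pos_chain => //; apply: binom_pos_coprime; [lia | lia |].
rewrite coprime_sym /coprime -[X in gcdn _ X](subnK (ltnW lt_b0)) gcdnDl.
by rewrite -/(coprime _ _) coprime_subl // ltnW.
Qed.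

(** * From [G] to theta sums with natural exponents *)

Lemma qprod_cat n m : qprod n m * qprod 0 n = qprod 0 (n + m).
Proof.
elim: m => [|m IHm]; first by rewrite addn0 /qprod big_geq ?mul1r.
by rewrite addnS qprodS qprod0S -IHm addnS; ring.
Qed.

Lemma gauss_natE n m : gauss_nat n m = qbin (n + m) m.
Proof.
apply: (mulIf (mulf_neq0 (qprod0_neq0 n) (qprod0_neq0 m))).
by rewrite qbin_fact (mulrC (qprod 0 n)) mulrA gauss_natK qprod_cat.
Qed.

(** The reflection M - x -> M + x leaves only |j|; for K |j| > M both sides vanish. *)
Lemma gauss_qbin (M K : nat) (j : int) :
  gauss (M%:Z + M%:Z) (M%:Z - K%:Z * j) = qbin (M + M) (M + K * `|j|).
Proof.
rewrite /gauss; have [le_KM|lt_MK] := leqP (K * `|j|) M; last first.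
  rewrite qbin_small; last by lia.
  by rewrite ifF //; case: j lt_MK => j /=; lia.
rewrite ifT; last by case: j le_KM => j /=; lia.
rewrite gauss_natE.
have [j_ge0|j_lt0] := leP 0 j.
  rewrite -(@qbin_sub (M + M) (M + K * `|j|)); last by lia.
  have : (K%:Z * j = (K * `|j|)%N%:Z) by rewrite PoszM; congr (_ * _); lia.
  by move=> ->; congr qbin; lia.
have : (K%:Z * j = - (K * `|j|)%N%:Z) by rewrite PoszM -mulrN; congr (_ * _); lia.
by move=> ->; congr qbin; lia.
Qed.

Lemma qshift_nat (R : realType) (e k : nat) (p : {poly int}) :
  qshift (e%:R : R) p k%:R = ('X^e * p)`_k.
Proof.
rewrite /qshift coefXnM; case: ltnP => [lt_ke|le_ek].
  by rewrite big1 // => i; rewrite -natrD eqr_nat => /eqP; lia.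
have [lt_k|le_k] := ltnP (k - e) (size p).
  rewrite (bigD1 (Ordinal lt_k)) /=; last by rewrite -natrD subnKC.
  rewrite big1 ?addr0 // => i /andP[]; rewrite -natrD eqr_nat => /eqP E /negP[].
  by apply/eqP/val_inj => /=; lia.
rewrite nth_default // big1 // => i; rewrite -natrD eqr_nat => /eqP E.
by have := ltn_ord i; lia.
Qed.

Lemma qshift_eq0 (R : realType) (e : nat) (p : {poly int}) (x : R) :
  (forall k : nat, x != k%:R) -> qshift e%:R p x = 0.
Proof.
by move=> x_nat; rewrite /qshift big1 // => i; rewrite -natrD (negbTE (x_nat _)).
Qed.

(** Natural exponents make the coefficient at a non-natural x vanish; at a natural x it is a
    coefficient of [theta_sum]. *)
Lemma nonneg_G (R : realType) (M c K : nat) (alpha beta : R) (Kz : int) :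
  Kz = K%:Z -> (0 < K)%N -> binom_pos M c K ->
  (forall j : int,
    Kz%:~R * j%:~R * ((alpha + beta) * j%:~R + alpha - beta) / 2 =
    (c * (`|j| * `|j|) + tri j)%N%:R) ->
  nonneg_coefs (G M%:Z M%:Z alpha beta Kz).
Proof.
move=> -> K_gt0 posK expE x; rewrite /G.
(* As K > 0, every j with |j| > M has K |j| > M and contributes zero. *)
pose J : seq int := [seq i%:Z - M%:Z | i <- iota 0 (M + M).+1].
have uniqJ : uniq J by rewrite map_inj_uniq ?iota_uniq // => i j; lia.
have memJ (j : int) : (j \in J) = (`|j| <= M)%N.
  apply/mapP/idP => [[i]|le_j]; first by rewrite mem_iota => ? ->; lia.
  by exists (absz (j + M%:Z)); rewrite ?mem_iota; lia.
pose F (j : int) : int := (-1) ^+ `|j|%N *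
  qshift ((c * (`|j| * `|j|) + tri j)%N%:R : R) (qbin (M + M) (M + K * `|j|)) x.
rewrite (eq_fsbigr F); last by move=> j _; rewrite expE gauss_qbin.
rewrite (@fsbigE _ _ _ _ _ J) //; last first.
  move=> j _; rewrite memJ -ltnNge => lt_Mj; rewrite /F qbin_small.
    by rewrite /qshift size_poly0 big_ord0 mulr0.
  by have := leq_pmull `|j| K_gt0; lia.
rewrite (eq_bigl xpredT); last by move=> j; rewrite in_setT.
have [[k xk]|x_nat] := pselect (exists k : nat, x = k%:R); last first.
  rewrite big1 // => j _; rewrite /F qshift_eq0 ?mulr0 // => k.
  by apply/eqP => xk; apply: x_nat; exists k.
have := posK M (leqnn M) k; rewrite /theta_sum coef_sum /J big_map.
rewrite -[iota _ _]/(index_iota 0 (M + M).+1) big_mkord.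
move=> theta_ge0; apply: (le_trans theta_ge0).
rewrite le_eqVlt; apply/orP; left; apply/eqP; apply: eq_bigr => i _.
by rewrite /F xk qshift_nat -signr_odd -[in RHS]signr_odd !mulr_sign; case: ifP => // _; rewrite coefN.
Qed.

(** * Base-4 digits of mu *)

Section TailSums.

Variables (n : nat) (abar : 'I_n.+1 -> int).
Hypothesis ha0 : 0 <= abar ord0.
Hypothesis hai : forall i : 'I_n.+1, (0 < i < n)%N -> 1 <= abar i.
Hypothesis han : 3 - (n == 0%N)%:Z <= abar ord_max.

Definition tail_sum (m : nat) : int := \sum_(k < n.+1 | (m <= k)%N) abar k.

Lemma tail_sumE m (lt_mn : (m < n.+1)%N) :
  tail_sum m = abar (Ordinal lt_mn) + tail_sum m.+1.
Proof.
rewrite /tail_sum (bigD1 (Ordinal lt_mn)) //=; congr (_ + _).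
by apply: eq_bigl => k; rewrite ltn_neqAle andbC -val_eqE /= eq_sym.
Qed.

Lemma tail_sum_last : 3 - (n == 0%N)%:Z <= tail_sum n.
Proof.
rewrite (tail_sumE (ltnSn n)) /tail_sum big1 ?addr0; last first.
  by move=> k; have := ltn_ord k; lia.
by apply: (le_trans han); rewrite le_eqVlt; apply/orP; left; apply/eqP; congr abar; apply: val_inj.
Qed.

(** The dropped entries have indices strictly between 0 and n, so each is at least 1. *)
Lemma tail_sum_decr e m : (0 < m)%N -> (m + e <= n)%N -> tail_sum (m + e) + e%:Z <= tail_sum m.
Proof.
move=> m_gt0; elim: e => [|e IHe] le_n; first by rewrite addn0 addr0.
have lt_n : (m + e < n.+1)%N by lia.
have := IHe (ltnW _); rewrite (tail_sumE lt_n) addnS -addnS => /(_ le_n).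
by have := @hai (Ordinal lt_n); rewrite /= addnS; lia.
Qed.

Lemma tail_sum_ge3 m : (0 < m <= n)%N -> 3 <= tail_sum m.
Proof.
case/andP=> m_gt0 le_mn; have := @tail_sum_decr (n - m) m m_gt0.
by rewrite subnKC // => /(_ (leqnn _)); have := tail_sum_last; lia.
Qed.

(** Together with [tail_sum_ge3] this places each exponent [tail_sum i - 2] among the positions 1,
    ..., d - 2. *)
Lemma tail_sum_le m : (0 < m <= n)%N -> tail_sum m <= tail_sum 0.
Proof.
case/andP=> m_gt0 le_mn.
have -> : tail_sum 0 = abar ord0 + tail_sum 1.
  by rewrite (tail_sumE (ltn0Sn n)); congr (abar _ + _); apply: val_inj.
have := @tail_sum_decr m.-1 1 isT; rewrite add1n prednK // => /(_ le_mn).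
by move: ha0; lia.
Qed.

Lemma tail_sum0_ge2 : 2 <= tail_sum 0.
Proof.
have [n0|n_gt0] := posnP n; first by have := tail_sum_last; rewrite {2}n0; lia.
have := @tail_sum_le n; rewrite n_gt0 leqnn => /(_ isT).
by have := @tail_sum_ge3 n; rewrite n_gt0 leqnn => /(_ isT); lia.
Qed.

Lemma tail_sum_inj (i j : 'I_n.+1) : (0 < i)%N -> (0 < j)%N ->
  tail_sum i = tail_sum j -> i = j.
Proof.
move=> i_gt0 j_gt0 eq_t; apply/val_inj => /=.
have le_i := ltn_ord i; have le_j := ltn_ord j.
wlog lt_ij : i j i_gt0 j_gt0 eq_t le_i le_j / (i < j)%N => [wlog_lt|].
  case: (ltngtP i j) => // lt_ij; first exact: wlog_lt.
  by apply/esym/wlog_lt.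
have := @tail_sum_decr (j - i) i i_gt0.
have -> : (i + (j - i) = j)%N by lia.
by rewrite eq_t; lia.
Qed.

(** This is eps_s: the geometric part of mu has all digits 2, and each tail with
    [tail_sum i - 2 = s] removes one 4^s. Tails being distinct, at most one unit is removed. *)
Definition mu_digit (s : nat) : nat :=
  2 - \sum_(i < n.+1 | (0 < i)%N) (tail_sum i - 2 == s%:Z)%R.

Lemma tail_count_le1 s : (\sum_(i < n.+1 | (0 < i)%N) (tail_sum i - 2 == s%:Z)%R <= 1)%N.
Proof.
rewrite -big_mkcondr /= sum1_card; apply/card_le1_eqP => i j.
move=> /andP[i_gt0 /eqP ti] /andP[j_gt0 /eqP tj].
by apply: tail_sum_inj => //; lia.
Qed.

Lemma mu_digit12 s : mu_digit s \in [:: 1; 2]%N.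
Proof. by have := tail_count_le1 s; rewrite /mu_digit !inE; lia. Qed.

Lemma mu_digit0 : mu_digit 0 = 2%N.
Proof.
rewrite /mu_digit big1 // => i i_gt0.
have := @tail_sum_ge3 i; rewrite i_gt0 -ltnS ltn_ord => /(_ isT).
by case: eqP => //; lia.
Qed.

Lemma mu_digitE (R : realType) :
  mu R abar = (\sum_(s < `|tail_sum 0 - 1|) mu_digit s * 4 ^ s)%N%:R.
Proof.
have t0_ge2 := tail_sum0_ge2; rewrite /mu.
have -> : \sum_i abar i = tail_sum 0 by apply: eq_bigl.
set D := `|tail_sum 0 - 1|%N.
have -> : tail_sum 0 - 1 = D%:Z by lia.
have geo : 2 / 3 * (4 ^+ D - 1) = (\sum_(s < D) 2 * 4 ^ s)%N%:R :> R.
  elim: (D) => [|k IHk]; first by rewrite big_ord0 expr0 subrr mulr0.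
  rewrite big_ord_recr natrD /= -IHk natrM natrX exprS.
  have : (3 : R) != 0 by rewrite pnatr_eq0.
  by move=> ?; field.
(* Exchanging the sums, each i is counted at the single position s = [tail_sum i - 2], which lies
   below D. *)
have tails : \sum_(i < n.+1 | (0 < i)%N) 4 ^ (tail_sum i - 2) =
    (\sum_(s < D) (\sum_(i < n.+1 | (0 < i)%N) (tail_sum i - 2 == s%:Z)%R) * 4 ^ s)%N%:R :> R.
  under [in RHS]eq_bigr do rewrite big_distrl.
  rewrite exchange_big /= natr_sum; apply: eq_bigr => i i_gt0.
  have i_in : (0 < i <= n)%N by rewrite i_gt0 -ltnS ltn_ord.
  have := tail_sum_ge3 i_in; have := tail_sum_le i_in => le_t ge_t.
  have lt_D : (`|tail_sum i - 2| < D)%N by lia.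
  rewrite (bigD1 (Ordinal lt_D)) //= big1 => [|s ne_s].
    have -> : tail_sum i - 2 = `|tail_sum i - 2|%N%:Z by lia.
    by rewrite eqxx mul1n addn0 natrX.
  rewrite (_ : (_ == _) = false) ?mul0n //.
  by apply: contraNF ne_s => /eqP ts; rewrite -val_eqE /=; lia.
rewrite -[4 ^ D%:Z]/(4 ^+ D) geo; move: tails; rewrite /tail_sum => ->.
apply/eqP; rewrite subr_eq -natrD eqr_nat -big_split /=; apply/eqP.
apply: eq_bigr => s _; rewrite -mulnDl subnK //.
exact: leq_trans (tail_count_le1 s) _.
Qed.

End TailSums.

(** * Choice of the starting pair and evaluation of the exponents of [G] *)

Unset Implicit Arguments.

Theorem theorem6p2 (R : realType) (n : nat) (abar : 'I_n.+1 -> int)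
    (ha0 : 0 <= abar ord0)
    (hai : forall i : 'I_n.+1, (0 < i < n)%N -> 1 <= abar i)
    (han : 3 - (n == 0%N)%:Z <= abar ord_max)
    (d : int) (hd : d = \sum_i abar i)
    (a b : int) (hab : coprimez a b)
    (hlo : (mu R abar - 1) * a%:~R < b%:~R)
    (hhi : b%:~R < (mu R abar + 1) * a%:~R)
    (M : nat) :
  nonneg_coefs
    (G M%:Z M%:Z
       (b%:~R / 2 ^ (d - 1) : R)
       ((b%:~R + 1 / a%:~R) / 2 ^ (d - 1))
       (2 ^ (d - 1) * a)).
Proof.
have t0_ge2 := tail_sum0_ge2 ha0 hai han.
have dE : d = tail_sum abar 0 by rewrite hd; apply: eq_bigl.
have [D DE] : exists D : nat, d - 1 = D.+1%:Z by exists `|d - 2|%N; lia.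
have := mu_digitE ha0 hai han R; rewrite -dE DE absz_nat.
set m := (\sum_(s < _) _)%N => muE.
(* The open interval containing b has length 2a. *)
have a_gt0 : 0 < a.
  have : (mu R abar - 1) * a%:~R < (mu R abar + 1) * a%:~R := lt_trans hlo hhi.
  by rewrite -subr_gt0 -mulrBl => ?; rewrite -(ltr_int R); lra.
move: hlo hhi; rewrite {}muE.
have -> : (m%:R - 1 : R) = (m%:Z - 1)%:~R by rewrite intrB.
have -> : (m%:R + 1 : R) = (m%:Z + 1)%:~R by rewrite intrD.
rewrite -!intrM !ltr_int => lo hi.
(* The lowest digit is 2; hence b > (m - 1) a > 0, so that a b is a natural exponent. *)
have m_ge2 : (2 <= m)%N by rewrite /m big_ord_recl mu_digit0 // leq_addr.
have aE : a = `|a|%N%:Z by lia.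
have ab_ge0 : 0 <= a * b by nia.
(* The bounds on b say |b0| < a; moreover a b = a b0 + m a^2, and b0 is coprime to a because b
   is. *)
pose b0 := b - m%:Z * a.
have pos : binom_pos M `|a * b| (`|a| * 2 ^ D.+1).
  apply: (@binom_pos_coprime_chain _ _ _ b0 (mu_digit abar)).
  - by rewrite /b0; nia.
  - rewrite -[coprime _ _]/(coprimez a b0) /coprimez.
    by rewrite (_ : b0 = - m%:Z * a + b) ?gcdzMDl // /b0 mulNr addrC.
  - exact: mu_digit12.
  - exact: mu_digit0.
  by rewrite /b0 -/m -aE; nia.
apply: (nonneg_G _ _ pos) => [||j].
- by rewrite PoszM -aE mulrC -[(2 ^ _)%N%:Z]natz natrX.
- by rewrite muln_gt0 expn_gt0 andbT; lia.
(* With P = 2^(d-1), alpha + beta = (2b + 1/a)/P and alpha - beta = -1/(a P), so the exponent for K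
   = P a is a b j^2 + j (j - 1)/2. *)
have triR : (tri j)%:R = j%:~R * (j%:~R - 1) / 2 :> R.
  apply: (mulIf (x := 2)); first by rewrite pnatr_eq0.
  rewrite divfK ?pnatr_eq0 //; have := congr1 (fun z : int => z%:~R : R) (triE j).
  by rewrite /= !intrM intrB => <-.
have absR : (absz (a * b)%R * (absz j * absz j))%N%:R = a%:~R * b%:~R * (j%:~R * j%:~R) :> R.
  rewrite -!intrM pmulrn; congr (_%:~R); rewrite !PoszM !abszE ger0_norm //.
  by rewrite -normrM ger0_norm // -expr2 sqr_ge0.
rewrite natrD {}absR triR intrM -[2 ^ _ : int]/(2 ^+ D.+1) rmorphXn /=.
rewrite -[2 ^ _]/(2 ^+ D.+1) -[2%:~R]/(2 : R).
have P_neq0 : 2 ^+ D.+1 != 0 :> R by rewrite expf_neq0 ?pnatr_eq0.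
have a_neq0 : a%:~R != 0 :> R by rewrite intr_eq0; lia.
move: P_neq0; move: (2 ^+ D.+1) => P P_neq0.
by field; rewrite P_neq0 a_neq0.
Qed.
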